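(* Let $(X,u,y)\sim P$, where $X$ is an $n\times m$ random matrix of covariates and $u,y$ are random vectors in $\mathbb{R}^n$, satisfying the standing assumptions in the context. Let $\hat{\mathbb{E}}(y|X)=X(X^\top X)^{-1}X^\top y$ be the linear regression predictions trained on $y$. Let $\beta=\arg\min_{w\in\mathbb{R}^m}\mathbb{E}(\|Xw-u\|^2)$. Let $e=y-u$ be the measurement error, let $M=[X\ \ u]$ be the $n\times(m+1)$ random matrix obtained by appending $u$ as a last column to $X$, and let $[\alpha\ \ \gamma]$, with $\alpha\in\mathbb{R}^m$ and $\gamma\in\mathbb{R}$, be a minimizer, i.e. $$[\alpha\ \ \gamma]=\arg\min_{w\in\mathbb{R}^{m+1}}\mathbb{E}(\|Mw-e\|^2).$$ Then $$\mathbb{E}\big[(u-\hat{\mathbb{E}}(y|X))^\top X\big]=-(\gamma\beta+\alpha)^\top\,\mathbb{E}(X^\top X).$$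
   Context: Standing assumptions: $u$ (the true outcome) and $y$ (the proxy outcome) are random vectors in $\mathbb{R}^n$. $X$ is a random $n\times m$ matrix of covariates whose first column is the all-ones vector and whose other columns are centered (mean zero), and the $m\times m$ matrix $\mathbb{E}(X^\top X)$ has full rank. The matrix $X^\top X$ is almost surely invertible, so that $\hat{\mathbb{E}}(y|X)$ is defined. $P$ is the joint probability distribution of $(X,u,y)$; the entries of $X,u,y$ are assumed square-integrable, so that all expectations appearing exist. No independence between $X$, $u$, $y$ is assumed. $\|\cdot\|$ is the Euclidean norm on $\mathbb{R}^n$, and $\mathbb{E}$ is expectation with respect to $P$. Despite the notation, $\hat{\mathbb{E}}(y|X)$ is not a conditional expectation but the random vector in $\mathbb{R}^n$ given by the formula in the claim. *)

(* Defs.v *)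
From mathcomp Require Import all_boot all_order all_algebra.
From mathcomp Require Import all_classical all_reals all_analysis.

Set Implicit Arguments.
Unset Strict Implicit.
Unset Printing Implicit Defensive.

Import Order.TTheory GRing.Theory Num.Theory.
Local Open Scope ring_scope.
Local Open Scope classical_set_scope.

(* The norm `|_| that the library puts on matrices is the sup norm. *)
Definition euclidean_norm (R : realType) (n : nat) (v : 'cV[R]_n) : R :=
  Num.sqrt (\sum_(i < n) v i ord0 ^+ 2).

(* Membership in Lfun includes measurability. *)
Definition sq_integrable_mx (d : measure_display) (T : measurableType d)
    (R : realType) (P : probability T R) (p q : nat)
    (A : T -> 'M[R]_(p, q)) : Prop :=
  forall i j, (fun t => A t i j) \in Lfun P 2%:E.

Definition integrable_mx (d : measure_display) (T : measurableType d)
    (R : realType) (P : probability T R) (p q : nat)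
    (A : T -> 'M[R]_(p, q)) : Prop :=
  forall i j, P.-integrable [set: T] (fun t => (A t i j)%:E).

(* Only meaningful when A satisfies integrable_mx: fine sends infinities to 0. *)
Definition expectation_mx (d : measure_display) (T : measurableType d)
    (R : realType) (P : probability T R) (p q : nat)
    (A : T -> 'M[R]_(p, q)) : 'M[R]_(p, q) :=
  \matrix_(i, j) fine 'E_P[fun t => A t i j]%E.

Definition is_argmin (R : realType) (W : Type) (f : W -> \bar R) (w : W) : Prop :=
  forall w', (f w <= f w')%E.

Definition mean_sq_error (d : measure_display) (T : measurableType d)
    (R : realType) (P : probability T R) (n k : nat)
    (A : T -> 'M[R]_(n, k)) (v : T -> 'cV[R]_n) (w : 'cV[R]_k) : \bar R :=
  'E_P[fun t => (euclidean_norm (A t *m w - v t) ^+ 2)%R]%E.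

(* invmx is the identity on singular matrices, so this is the regression
   prediction only where X^T *m X is invertible. *)
Definition ols_prediction (R : realType) (n m : nat)
    (X : 'M[R]_(n, m)) (y : 'cV[R]_n) : 'cV[R]_n :=
  X *m invmx (X^T *m X) *m X^T *m y.

(* Main.v *)
(* A least-squares minimizer w of E|A w - v|^2 satisfies the normal equation
   E(A^T v) = E(A^T A) w. Applied to [X u] and e = y - u, keeping only the rows
   of X, it gives E(X^T e) = E(X^T X) alpha + gamma E(X^T u), and applied to X
   and u it gives E(X^T u) = E(X^T X) beta. Since X^T X (X^T X)^-1 X^T y = X^T y
   wherever X^T X is invertible, X^T (u - prediction) = - X^T e almost surely. *)
Require Import Defs.
From mathcomp Require Import all_boot all_order all_algebra.
From mathcomp Require Import all_classical all_reals all_analysis.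
From mathcomp Require Import measurable_realfun ring lra.

Set Implicit Arguments.
Unset Strict Implicit.
Unset Printing Implicit Defensive.

Import Order.TTheory GRing.Theory Num.Theory.
Local Open Scope ring_scope.
Local Open Scope classical_set_scope.

Definition measurable_mx (d : measure_display) (T : measurableType d)
    (R : realType) (p q : nat) (A : T -> 'M[R]_(p, q)) : Prop :=
  forall i j, measurable_fun [set: T] (fun t => A t i j).

(** * Measurability of matrix operations, up to the regression prediction *)

Section measurability.
Context (d : measure_display) (T : measurableType d) (R : realType).

Lemma measurable_inv (f : T -> R) :
  measurable_fun setT f -> measurable_fun setT (fun t => (f t)^-1).
Proof.
move=> mf.
(* x^-1 = x * (x^2)^-1 also at x = 0, and the library has powers of nonnegative reals *)
have -> : (fun t => (f t)^-1) = (fun t => f t * (f t ^+ 2) `^ (-1)).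
  apply/funext => t; rewrite powR_inv1 ?sqr_ge0//.
  have [->|f0] := eqVneq (f t) 0; first by rewrite invr0 mul0r.
  by rewrite expr2 invfM mulrA divff// mul1r.
apply: measurable_funM => //.
by apply: (measurableT_comp (measurable_powR _)); exact: measurable_funX.
Qed.

Lemma measurable_mx_tr p q (A : T -> 'M[R]_(p, q)) :
  measurable_mx A -> measurable_mx (fun t => (A t)^T).
Proof. by move=> mA i j; under eq_fun do rewrite mxE; exact: mA. Qed.

Lemma measurable_mxB p q (A B : T -> 'M[R]_(p, q)) :
  measurable_mx A -> measurable_mx B -> measurable_mx (fun t => A t - B t).
Proof.
by move=> mA mB i j; under eq_fun do rewrite !mxE; exact: measurable_funB.
Qed.

Lemma measurable_mxM p q r (A : T -> 'M[R]_(p, q)) (B : T -> 'M[R]_(q, r)) :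
  measurable_mx A -> measurable_mx B -> measurable_mx (fun t => A t *m B t).
Proof.
move=> mA mB i j; under eq_fun do rewrite mxE.
by apply: measurable_sum => k; exact: measurable_funM.
Qed.

Lemma measurable_det p (A : T -> 'M[R]_p) :
  measurable_mx A -> measurable_fun setT (fun t => \det (A t)).
Proof.
move=> mA; apply: measurable_sum => s; apply: measurable_funM => //.
by apply: measurable_prod => i _; exact: mA.
Qed.

(** Cramer's rule writes an entry as a cofactor divided by the determinant where the latter is
    nonzero; elsewhere [invmx] returns [A t] itself. Both branches and the test between them are
    measurable. *)
Lemma measurable_invmx p (A : T -> 'M[R]_p) :
  measurable_mx A -> measurable_mx (fun t => invmx (A t)).
Proof.
move=> mA i j.
have -> : (fun t => invmx (A t) i j) = (fun t =>
    if ~~ (\det (A t) == 0) then (\det (A t))^-1 * cofactor (A t) j i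
    else A t i j).
  by apply/funext => t; rewrite /invmx unitmxE unitfE; case: ifP; rewrite ?mxE.
have mdet := measurable_det mA.
apply: measurable_fun_ifT => //; last first.
- apply: measurable_funM; first exact: measurable_inv.
  apply: measurable_funM => //; apply: measurable_det => k l.
  by under eq_fun do rewrite !mxE; exact: mA.
- by apply: measurable_neg; exact: measurable_fun_eqr.
Qed.

Lemma measurable_ols_prediction n m (X : T -> 'M[R]_(n, m)) (y : T -> 'cV[R]_n) :
  measurable_mx X -> measurable_mx y ->
  measurable_mx (fun t => ols_prediction (X t) (y t)).
Proof.
move=> mX my; have mXT := measurable_mx_tr mX.
do 3 apply: measurable_mxM => //.
exact/measurable_invmx/measurable_mxM.
Qed.

End measurability.

(** * Linearity of matrix expectations, and invariance under almost sure equality *)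

Section expectation_mx.
Context (d : measure_display) (T : measurableType d) (R : realType).
Context (P : probability T R).

(** An integrable entry has a finite integral, so [fine] loses nothing and the rules for extended
    real integrals apply. *)
Lemma expectation_mxE p q (A : T -> 'M[R]_(p, q)) i j :
  integrable_mx P A -> (expectation_mx P A i j)%:E = (\int[P]_t (A t i j)%:E)%E.
Proof.
move=> iA; rewrite mxE fineK; first by rewrite unlock.
by rewrite unlock; exact: integrable_fin_num (iA i j).
Qed.

Lemma integrable_mxD p q (A B : T -> 'M[R]_(p, q)) :
  integrable_mx P A -> integrable_mx P B ->
  integrable_mx P (fun t => A t + B t).
Proof.
move=> iA iB i j; under eq_fun do rewrite mxE EFinD.
exact: integrableD (iA i j) (iB i j).
Qed.

Lemma expectation_mxD p q (A B : T -> 'M[R]_(p, q)) :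
  integrable_mx P A -> integrable_mx P B ->
  expectation_mx P (fun t => A t + B t) = expectation_mx P A + expectation_mx P B.
Proof.
move=> iA iB; apply/matrixP => i j; apply: EFin_inj.
rewrite [X in _ = X%:E]mxE EFinD !expectation_mxE//; last exact: integrable_mxD.
rewrite -integralD//.
by apply: eq_integral => t _; rewrite mxE EFinD.
Qed.

Lemma integrable_mxMl p q r (C : 'M[R]_(p, q)) (A : T -> 'M[R]_(q, r)) :
  integrable_mx P A -> integrable_mx P (fun t => C *m A t).
Proof.
move=> iA i j; under eq_fun do rewrite mxE -sumEFin.
apply: integrable_sum => // k _; under eq_fun do rewrite EFinM.
exact: integrableZl (iA k j).
Qed.

Lemma expectation_mxMl p q r (C : 'M[R]_(p, q)) (A : T -> 'M[R]_(q, r)) :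
  integrable_mx P A ->
  expectation_mx P (fun t => C *m A t) = C *m expectation_mx P A.
Proof.
move=> iA; apply/matrixP => i j; apply: EFin_inj.
rewrite expectation_mxE; last exact: integrable_mxMl.
rewrite [X in _ = X%:E]mxE -sumEFin; under eq_integral do rewrite mxE -sumEFin.
rewrite integral_sum//; last first.
  by move=> k; under eq_fun do rewrite EFinM; exact: integrableZl (iA k j).
apply: eq_bigr => k _; rewrite EFinM expectation_mxE//.
under eq_integral do rewrite EFinM.
by rewrite integralZl//; exact: iA.
Qed.

Lemma integrable_mx_tr p q (A : T -> 'M[R]_(p, q)) :
  integrable_mx P A -> integrable_mx P (fun t => (A t)^T).
Proof. by move=> iA i j; under eq_fun do rewrite mxE; exact: iA. Qed.

Lemma expectation_mx_tr p q (A : T -> 'M[R]_(p, q)) :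
  expectation_mx P (fun t => (A t)^T) = (expectation_mx P A)^T.
Proof. by apply/matrixP => i j; rewrite !mxE; under eq_fun do rewrite mxE. Qed.

Lemma integrable_mxMr p q r (A : T -> 'M[R]_(p, q)) (C : 'M[R]_(q, r)) :
  integrable_mx P A -> integrable_mx P (fun t => A t *m C).
Proof.
move=> iA; under eq_fun do rewrite -[A _ *m C]trmxK trmx_mul.
exact/integrable_mx_tr/integrable_mxMl/integrable_mx_tr.
Qed.

(** Reduces to multiplication on the left through A C = (C^T A^T)^T. *)
Lemma expectation_mxMr p q r (A : T -> 'M[R]_(p, q)) (C : 'M[R]_(q, r)) :
  integrable_mx P A ->
  expectation_mx P (fun t => A t *m C) = expectation_mx P A *m C.
Proof.
move=> iA; under eq_fun do rewrite -[A _ *m C]trmxK trmx_mul.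
rewrite expectation_mx_tr expectation_mxMl; last exact: integrable_mx_tr.
by rewrite expectation_mx_tr trmx_mul !trmxK.
Qed.

(** Lets the regression residual, controlled only where X^T X is invertible, inherit integrability
    and expectation from a product of square-integrable matrices. As [P] need not be complete,
    measurability of [B] does not follow from that of [A]. *)
Lemma ae_eq_integrable_mx p q (A B : T -> 'M[R]_(p, q)) :
  integrable_mx P A -> measurable_mx B -> {ae P, forall t, A t = B t} ->
  integrable_mx P B /\ expectation_mx P B = expectation_mx P A.
Proof.
move=> iA mB AB.
have ABij i j : ae_eq P setT (fun t => (A t i j)%:E) (fun t => (B t i j)%:E).
  by apply: filterS AB => t -> _.
have mA i j : measurable_fun setT (fun t => (A t i j)%:E).
  exact: measurable_int (iA i j).
have mBE i j : measurable_fun setT (fun t => (B t i j)%:E).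
  exact/measurable_EFinP.
split=> [i j|].
  have /integrableP[_ foo] := iA i j; apply/integrableP; split => //.
  rewrite (@ae_eq_integral _ _ _ P setT (fun t => `|(A t i j)%:E|)%E)//.
  - exact: measurableT_comp (mBE i j).
  - exact: measurableT_comp (mA i j).
  - by apply: filterS (ABij i j) => t h /h ->.
apply/matrixP => i j; rewrite !mxE unlock; congr fine.
by apply/esym; apply: ae_eq_integral => //.
Qed.

(** * Closure properties of square-integrable random matrices *)

Lemma sq_integrable_mx_tr p q (A : T -> 'M[R]_(p, q)) :
  sq_integrable_mx P A -> sq_integrable_mx P (fun t => (A t)^T).
Proof. by move=> sA i j; under eq_fun do rewrite mxE; exact: sA. Qed.

Let Lfun2_submod : GRing.submod_closed (Lfun P 2%:E : {pred T -> R}).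
Proof. by apply: Lfun_submod_closed; rewrite lee1n. Qed.

Lemma sq_integrable_mxB p q (A B : T -> 'M[R]_(p, q)) :
  sq_integrable_mx P A -> sq_integrable_mx P B ->
  sq_integrable_mx P (fun t => A t - B t).
Proof.
(* Closure of L^2 is available for combinations a f + g, so the difference is put in the form (-1) B
   + A. *)
move=> sA sB i j; under eq_fun do rewrite !mxE addrC -mulN1r.
exact: (Lfun2_submod.2 (-1) _ _ (sB i j) (sA i j)).
Qed.

Lemma sq_integrable_mxMr p q r (A : T -> 'M[R]_(p, q)) (C : 'M[R]_(q, r)) :
  sq_integrable_mx P A -> sq_integrable_mx P (fun t => A t *m C).
Proof.
move=> sA i j; under eq_fun do rewrite mxE.
elim: (index_enum _) => [|k s ih].
  by under eq_fun do rewrite big_nil; exact: Lfun2_submod.1.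
under eq_fun do rewrite big_cons mulrC.
exact: (Lfun2_submod.2 (C k j) _ _ (sA i k) ih).
Qed.

Lemma sq_integrable_mx_row p q r (A : T -> 'M[R]_(p, q)) (B : T -> 'M[R]_(p, r)) :
  sq_integrable_mx P A -> sq_integrable_mx P B ->
  sq_integrable_mx P (fun t => row_mx (A t) (B t)).
Proof.
move=> sA sB i j; under eq_fun do rewrite mxE.
by case: (fintype.split j) => k; [exact: sA|exact: sB].
Qed.

(** Each entry is a finite sum of products of two L^2 functions, which are in L^1 by Hölder's
    inequality. *)
Lemma sq_integrable_mxM p q r (A : T -> 'M[R]_(p, q)) (B : T -> 'M[R]_(q, r)) :
  sq_integrable_mx P A -> sq_integrable_mx P B ->
  integrable_mx P (fun t => A t *m B t).
Proof.
move=> sA sB i j; under eq_fun do rewrite mxE -sumEFin.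
by apply: integrable_sum => // k _; exact/Lfun1_integrable/Lfun2_mul_Lfun1.
Qed.

Lemma sq_integrable_mx_measurable p q (A : T -> 'M[R]_(p, q)) :
  sq_integrable_mx P A -> measurable_mx A.
Proof. by move=> sA i j; have /sub_Lfun_mfun := sA i j; rewrite inE. Qed.

(** * Least squares and the normal equation *)

Lemma mean_sq_errorE n k (A : T -> 'M[R]_(n, k)) (v : T -> 'cV[R]_n) w :
  sq_integrable_mx P A -> sq_integrable_mx P v ->
  mean_sq_error P A v w =
    (expectation_mx P (fun t => (A t *m w - v t)^T *m (A t *m w - v t)) 0 0)%:E.
Proof.
move=> sA sv.
have sr := sq_integrable_mxB (sq_integrable_mxMr w sA) sv.
rewrite expectation_mxE; last exact/sq_integrable_mxM/sr/sq_integrable_mx_tr.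
rewrite /mean_sq_error unlock; apply: eq_integral => t _; congr EFin.
rewrite sqr_sqrtr; last by apply: sumr_ge0 => i _; exact: sqr_ge0.
by rewrite [RHS]mxE; apply: eq_bigr => i _; rewrite [in RHS]mxE expr2.
Qed.

Lemma quadratic_min_at0 (b c : R) : (forall s, 0 <= 2 * s * b + s ^+ 2 * c) -> b = 0.
Proof.
move=> h; apply/eqP/negP => /negP b0.
have c1 : 0 < `|c| + 1 by rewrite ltr_wpDl.
(* This s has the sign opposite to b, and the denominator |c| + 1 is positive whatever the sign of
   c. The quadratic becomes -(b / (|c| + 1))^2 (2 (|c| + 1) - c), which is negative because c <=
   |c|. *)
have := h (- b / (`|c| + 1)).
have -> : 2 * (- b / (`|c| + 1)) * b + (- b / (`|c| + 1)) ^+ 2 * c =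
   - (b / (`|c| + 1)) ^+ 2 * (2 * (`|c| + 1) - c) by field; rewrite gt_eqF.
rewrite mulNr oppr_ge0 leNgt => /negP; apply; apply: mulr_gt0.
  by rewrite exprn_even_gt0//= mulf_neq0// invr_neq0// gt_eqF.
have := ler_norm c; have := normr_ge0 c; lra.
Qed.

Lemma trmx_mul_self_eq0 k (v : 'cV[R]_k) : (v^T *m v) 0 0 = 0 -> v = 0.
Proof.
rewrite mxE => /eqP; rewrite psumr_eq0 => [/allP h|i _]; last first.
  by rewrite mxE -expr2 sqr_ge0.
apply/colP => i; rewrite mxE; apply/eqP.
by have := h i (mem_index_enum _); rewrite mxE mulf_eq0 orbb.
Qed.

Lemma normal_equation n k (A : T -> 'M[R]_(n, k)) (v : T -> 'cV[R]_n) w :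
  sq_integrable_mx P A -> sq_integrable_mx P v ->
  is_argmin (mean_sq_error P A v) w ->
  expectation_mx P (fun t => (A t)^T *m v t) =
  expectation_mx P (fun t => (A t)^T *m A t) *m w.
Proof.
move=> sA sv wmin.
pose r t := A t *m w - v t.
have sAw := sq_integrable_mxMr w sA.
have sr : sq_integrable_mx P r := sq_integrable_mxB sAw sv.
have sAT := sq_integrable_mx_tr sA.
have iAr := sq_integrable_mxM sAT sr.
have iAA := sq_integrable_mxM sAT sA.
have irr := sq_integrable_mxM (sq_integrable_mx_tr sr) sr.
(* g is half the gradient of the error at w. Along g itself the first-order coefficient is a
   multiple of g^T g, so this single direction is enough to force g = 0. *)
pose g := expectation_mx P (fun t => (A t)^T *m r t).
have g0 : g = 0.
  (* the error along the line w + s g is its value at w plus 2 s |g|^2 + O(s^2) *)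
  apply: trmx_mul_self_eq0.
  apply: (@quadratic_min_at0 _
    ((g^T *m (expectation_mx P (fun t => (A t)^T *m A t) *m g)) 0 0)) => s.
  have := wmin (w + s *: g); rewrite !mean_sq_errorE// lee_fin.
  (* Expansion of |r + A h|^2 with h = s g, grouped so that the constant h stands outside A^T r and
     A^T A and can leave the expectation. *)
  have -> : (fun t => (A t *m (w + s *: g) - v t)^T *m
                      (A t *m (w + s *: g) - v t)) =
      (fun t => (r t)^T *m r t + (((s *: g)^T *m ((A t)^T *m r t) +
        ((A t)^T *m r t)^T *m (s *: g)) +
        (s *: g)^T *m ((A t)^T *m A t *m (s *: g)))).
    apply/funext => t.
    have -> : A t *m (w + s *: g) - v t = r t + A t *m (s *: g).
      by rewrite mulmxDr addrAC.
    move: (r t) (s *: g) => rt h.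
    rewrite !(linearD, mulmxDl, mulmxDr, trmx_mul, trmxK, mulmxA) /=.
    by rewrite -!addrA (trmx_mul (A t) h).
  have iAAg := integrable_mxMr (s *: g) iAA.
  have igAr := integrable_mxMl (s *: g)^T iAr.
  have iArg := integrable_mxMr (s *: g) (integrable_mx_tr iAr).
  have igAAg := integrable_mxMl (s *: g)^T iAAg.
  have igg := integrable_mxD igAr iArg.
  rewrite (expectation_mxD irr (integrable_mxD igg igAAg)).
  rewrite (expectation_mxD igg igAAg) (expectation_mxD igAr iArg).
  rewrite (expectation_mxMl _ iAAg) (expectation_mxMl _ iAr).
  rewrite (expectation_mxMr _ iAA) (expectation_mxMr _ (integrable_mx_tr iAr)).
  (* The error at w cancels from both sides; what remains is 0 <= 2 s b + s^2 c with b = g^T g and c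
     = g^T E(A^T A) g. *)
  rewrite expectation_mx_tr -/g [X in _ <= X]mxE lerDl.
  rewrite linearZ /= -!scalemxAl -!scalemxAr -scalerDl scalerA.
  by rewrite !mxE -mulr2n mulr_natl expr2.
have : g + expectation_mx P (fun t => (A t)^T *m v t) =
  expectation_mx P (fun t => (A t)^T *m A t) *m w.
  rewrite -expectation_mxD//; last exact: sq_integrable_mxM.
  rewrite -expectation_mxMr//; congr expectation_mx; apply/funext => t.
  by rewrite -mulmxDr subrK mulmxA.
by rewrite g0 add0r.
Qed.

End expectation_mx.

Theorem proposition2 (R : realType) (d : measure_display) (T : measurableType d)
  (P : probability T R) (n m : nat) (hm : (0 < m)%N)
  (X : T -> 'M[R]_(n, m)) (u y : T -> 'cV[R]_n)
  (X_sq : sq_integrable_mx P X)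
  (u_sq : sq_integrable_mx P u)
  (y_sq : sq_integrable_mx P y)
  (X_ones : {ae P, forall t, col (Ordinal hm) (X t) = const_mx 1})
  (X_centered : forall j : 'I_m, j != Ordinal hm ->
     expectation_mx P (fun t => col j (X t)) = 0)
  (EXX_full_rank : \rank (expectation_mx P (fun t => (X t)^T *m X t)) = m)
  (XX_unit : {ae P, forall t, (X t)^T *m X t \in unitmx})
  (beta : 'cV[R]_m)
  (beta_argmin : is_argmin (mean_sq_error P X u) beta)
  (alpha : 'cV[R]_m) (gamma : R)
  (alpha_gamma_argmin :
     is_argmin (mean_sq_error P (fun t => row_mx (X t) (u t))
                                (fun t => y t - u t))
               (col_mx alpha gamma%:M)) :
  integrable_mx P (fun t => (u t - ols_prediction (X t) (y t))^T *m X t) /\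
  expectation_mx P (fun t => (u t - ols_prediction (X t) (y t))^T *m X t)
    = - ((gamma *: beta + alpha)^T *m expectation_mx P (fun t => (X t)^T *m X t)).
Proof.
set EXX := expectation_mx P _ in EXX_full_rank *.
pose e t := y t - u t.
pose M t := row_mx (X t) (u t).
have sXT := sq_integrable_mx_tr X_sq.
have se : sq_integrable_mx P e := sq_integrable_mxB y_sq u_sq.
have sM : sq_integrable_mx P M := sq_integrable_mx_row X_sq u_sq.
have iXX := sq_integrable_mxM sXT X_sq.
have iXu := sq_integrable_mxM sXT u_sq.
have iXe := sq_integrable_mxM sXT se.
have EXu := normal_equation X_sq u_sq beta_argmin.
have EXe : expectation_mx P (fun t => (X t)^T *m e t) =
    EXX *m (gamma *: beta + alpha).
  have iMM := sq_integrable_mxM (sq_integrable_mx_tr sM) sM.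
  have iMe := sq_integrable_mxM (sq_integrable_mx_tr sM) se.
  have := normal_equation sM se alpha_gamma_argmin.
  (* The block row [1 0] selects the rows of M^T that come from X^T. It and the coefficient vector
     are moved inside the expectation, where the block products can be computed pointwise. *)
  rewrite -expectation_mxMr// => /(congr1 (mulmx (row_mx 1%:M 0))).
  rewrite -!expectation_mxMl//; last exact: integrable_mxMr.
  under eq_fun do rewrite tr_row_mx mul_col_mx mul_row_col mul1mx mul0mx addr0.
  move=> ->.
  under eq_fun do rewrite mulmxA tr_row_mx mulmxA mul_row_col mul1mx mul0mx
    addr0 -mulmxA mul_row_col mulmxDr !mulmxA.
  have iXXa := integrable_mxMr alpha iXX.
  have iXug := integrable_mxMr gamma%:M iXu.
  rewrite (expectation_mxD iXXa iXug).
  rewrite (expectation_mxMr _ iXX) (expectation_mxMr _ iXu).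
  by rewrite EXu mul_mx_scalar mulmxDr -scalemxAr addrC.
have ols_residual t : (X t)^T *m X t \in unitmx ->
    - ((X t)^T *m e t)^T = (u t - ols_prediction (X t) (y t))^T *m X t.
  move=> XXu; apply: trmx_inj; rewrite linearN /= trmxK trmx_mul trmxK.
  rewrite /e mulmxBr opprB mulmxBr /ols_prediction.
  by rewrite !mulmxA mulmxV// mul1mx.
(* With the right-hand side written as an expectation, one appeal to almost sure equality gives both
   integrability and the value. The sign is the factor [- 1%:M], so that linearity covers it. *)
have -> : - ((gamma *: beta + alpha)^T *m EXX) =
    expectation_mx P (fun t => (- 1%:M) *m ((X t)^T *m e t)^T).
  rewrite expectation_mxMl; last exact: integrable_mx_tr.
  rewrite expectation_mx_tr EXe trmx_mul mulNmx mul1mx; congr (- (_ *m _)).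
  (* E(X^T X) is symmetric. *)
  by rewrite /EXX -expectation_mx_tr; congr expectation_mx; apply/funext => t;
    rewrite trmx_mul trmxK.
apply: ae_eq_integrable_mx.
- by apply: integrable_mxMl; exact: integrable_mx_tr.
- have mX := sq_integrable_mx_measurable X_sq.
  have my := sq_integrable_mx_measurable y_sq.
  have mu := sq_integrable_mx_measurable u_sq.
  apply: (measurable_mxM _ mX); apply: measurable_mx_tr.
  by apply: measurable_mxB => //; exact: measurable_ols_prediction.
- by apply: filterS XX_unit => t /ols_residual <-; rewrite mulNmx mul1mx.
Qed.
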